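(* Let $S$ be a set of $n$ semi-algebraic geometric objects of constant complexity (in any dimension) with $t$ degrees of freedom, let $r$ be a growth parameter and $\Pi(o,o';r)$ an $r$-monotone semi-algebraic predicate of constant complexity over pairs $o,o'\in S$, and let $L$ be a parameter with $n\le L\ll\binom{n}{2}$. Then one can find an interval $I$ that contains the optimum value $r^*$ and contains at most $L$ critical values determined by pairs of objects in $S$, in randomized expected time $$O^*\left(\frac{n^{2t/(t+1)}}{L^{(t-1)/(t+1)}}+D(n)\right).$$
   Context: The number $t$ of degrees of freedom is the number of real parameters needed to specify an object. The predicate $\Pi$ is monotone in $r$: if $\Pi(o,o';r_1)$ is true then $\Pi(o,o';r_2)$ is true for every $r_2>r_1$. The critical value of a pair $o,o'\in S$ is $r_{o,o'}=\min\{r\mid \Pi(o,o';r)\text{ is true}\}$ (the minimum is assumed to be attained). $G(r)$ is the graph on $S$ whose edges are the pairs $(o,o')$ for which $\Pi(o,o';r)$ is true, and $r^*$ is the smallest value of $r$ for which some given monotone graph property (one preserved under adding edges) holds for $G(r)$. A decision procedure that determines, for an input $r$, whether $r$ is smaller than, equal to, or larger than $r^*$ is available, and $D(n)$ denotes its cost (running time). The interval sought is of the form $I=(\alpha,\beta]\subset\mathbb{R}$. The notation $O^*(\cdot)$ hides subpolynomial factors (factors that are $O(n^{\varepsilon})$ for every fixed $\varepsilon>0$). Running times are in the standard real-RAM model of computational geometry.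
   Formalization: The interval always contains r*, but contains at most L critical values only with probability at least 1 − n^(-c) for any prescribed c (certainty is impossible when the bound is sublinear and D(n) = O(1)); its endpoints may be infinite. *)

(* Defs.v *)
From HB Require Import structures.
From mathcomp Require Import all_boot all_order all_algebra.
From mathcomp Require Import all_classical all_reals all_analysis.
From mathcomp Require Import polyrcf ordered_qelim.

Set Implicit Arguments.
Unset Strict Implicit.
Unset Printing Implicit Defensive.

Import Order.TTheory GRing.Theory Num.Theory.

Local Open Scope classical_set_scope.
Local Open Scope ring_scope.

(* Boolean combination of polynomial equations and inequalities: no
   quantifier, no inverse. *)
Definition semialgebraic_formula (R : realType) (f : ord.formula R) : Prop :=
  ord.qf_form f /\ ord.rformula f.

Definition coords (R : realType) (m : nat) (x : 'rV[R]_m) : seq R :=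
  [seq x 0 i | i <- enum 'I_m].

(* The object of R^d specified by the t real parameters p.  One fixed formula
   Phi describes all objects, which is what constant complexity means: variables
   'X_0 .. 'X_(t-1) are the parameters, the next d ones are the coordinates. *)
Definition object (R : realType) (t d : nat) (Phi : ord.formula R)
    (p : 'rV[R]_t) : set 'rV[R]_d :=
  [set x | ord.holds (coords p ++ coords x) Phi].

(* The variables of f are the t parameters of each object, then r. *)
Definition semialgebraic_predicate (R : realType) (t d : nat)
    (Phi : ord.formula R)
    (Pi : set 'rV[R]_d -> set 'rV[R]_d -> R -> Prop) : Prop :=
  exists2 f : ord.formula R, semialgebraic_formula f &
    forall (p q : 'rV[R]_t) (r : R),
      Pi (object Phi p) (object Phi q) r <->
      ord.holds (coords p ++ coords q ++ [:: r]) f.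

Definition is_minimum (R : realType) (A : set R) (x : R) : Prop :=
  A x /\ lbound A x.

Section GrowthGraph.
Variables (R : realType) (T : Type) (Pi : T -> T -> R -> Prop).
Variables (n : nat) (o : 'I_n -> T).

Definition r_monotone : Prop :=
  forall (i j : 'I_n) (r1 r2 : R), i != j ->
    r1 < r2 -> Pi (o i) (o j) r1 -> Pi (o i) (o j) r2.

Definition critical_value (i j : 'I_n) (r : R) : Prop :=
  is_minimum [set s | Pi (o i) (o j) s] r.

Definition critical_values_attained : Prop :=
  forall i j : 'I_n, i != j -> exists r, critical_value i j r.

Definition critical_values : set R :=
  [set r | exists i j : 'I_n, i != j /\ critical_value i j r].

(* Pi is not assumed to be symmetric; when it is, this is a simple graph. *)
Definition growth_graph (r : R) : rel 'I_n :=
  fun i j => (i != j) && `[< Pi (o i) (o j) r >].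

End GrowthGraph.

Definition monotone_graph_property (n : nat) (P : rel 'I_n -> Prop) : Prop :=
  forall E E' : rel 'I_n, subrel E E' -> P E -> P E'.

(* ]a, b], as a set of real numbers; a and b may be infinite. *)
Definition half_open_itv (R : realType) (a b : \bar R) : set R :=
  [set x | (a < x%:E)%E && (x%:E <= b)%E].

(* Randomized real RAM.

   Two random access memories: N holds O(log n)-bit words, X holds real
   numbers.  There is no conversion from reals to words (no floor function):
   information flows from X to N only through comparisons.  In the comments
   below, d, a, b, k are constants occurring in the program. *)

Inductive instr (R : Type) : Type :=
| NConst of nat & nat              (* d k:   N[d] := k *)
| NAdd of nat & nat & nat          (* d a b: N[d] := N[a] + N[b] *)
| NSub of nat & nat & nat          (* truncated subtraction *)
| NMul of nat & nat & nat
| NDiv of nat & nat & nat          (* integer quotient *)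
| NLoad of nat & nat               (* d a:   N[d] := N[N[a]] *)
| NStore of nat & nat              (* d a:   N[N[d]] := N[a] *)
| NRandom of nat & nat             (* d a:   N[d] := uniform in 0..N[a]-1 *)
| XConst of nat & R                (* d c:   X[d] := c *)
| XAdd of nat & nat & nat          (* d a b: X[d] := X[a] + X[b] *)
| XSub of nat & nat & nat
| XMul of nat & nat & nat
| XDiv of nat & nat & nat
  (* d s k: X[d] := the k-th smallest real root (from 0) of the polynomial
     whose coefficients, by increasing degree, are the X[i], i in s; 0 if there
     is none.  The degree is bounded by the program text. *)
| XRoot of nat & seq nat & nat
| XLoad of nat & nat               (* d a:   X[d] := X[N[a]] *)
| XStore of nat & nat              (* d a:   X[N[d]] := X[a] *)
| XOfN of nat & nat                (* d a:   X[d] := N[a] *)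
| XInput of nat & nat & nat        (* d a k: X[d] := parameter k of object N[a] *)
  (* d a: call to the decision procedure on r = X[a]; N[d] := 0, 1, 2 according
     to whether r is smaller than, equal to, larger than the optimum *)
| Decide of nat & nat
| JumpN of nat & nat & nat         (* a b l: if N[a] <= N[b], go to line l *)
| JumpX of nat & nat & nat         (* a b l: if X[a] <= X[b], go to line l *)
  (* a b: stop and return the interval ]X[a], X[b]], where None stands for
     the corresponding infinite endpoint *)
| Halt of option nat & option nat.

Arguments NConst {R}. Arguments NAdd {R}. Arguments NSub {R}.
Arguments NMul {R}. Arguments NDiv {R}. Arguments NLoad {R}.
Arguments NStore {R}. Arguments NRandom {R}. Arguments XAdd {R}.
Arguments XSub {R}. Arguments XMul {R}. Arguments XDiv {R}.
Arguments XRoot {R}. Arguments XLoad {R}. Arguments XStore {R}.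
Arguments XOfN {R}. Arguments XInput {R}. Arguments Decide {R}.
Arguments JumpN {R}. Arguments JumpX {R}. Arguments Halt {R}.

(* Words are the integers below n.+1 ^ wordlen, so they have
   wordlen * log2 (n + 1) bits. *)
Record program (R : Type) := Program { wordlen : nat; code : seq (instr R) }.

Record config (R : Type) := Config {
  pc : nat; nmem : nat -> nat; xmem : nat -> R }.

(* What a configuration does: stop with a result, or, at the given cost, move
   to f v with v uniform in 'I_m. *)
Inductive action (R : Type) : Type :=
| Stop of set R
| Move (cost m : nat) (f : nat -> config R).

Section Semantics.
Variables (R : realType) (M : program R).
(* n objects, with parameters inp; L; optimum opt; cost D of a decision *)
Variables (n L : nat) (inp : nat -> nat -> R) (opt : R) (D : nat).

Definition word (k : nat) : nat := (k %% n.+1 ^ wordlen M)%N.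

Definition decide (r : R) : nat :=
  if r < opt then 0%N else if r == opt then 1%N else 2%N.

(* Running off the end of the program halts with the interval ]-oo, +oo[. *)
Definition step (c : config R) : action R :=
  let: Config l N X := c in
  let go l' N' X' := Move 1 1 (fun=> Config l' N' X') in
  let setN d k := go l.+1 [eta N with d |-> word k] X in
  let setX d x := go l.+1 N [eta X with d |-> x] in
  match nth (Halt None None) (code M) l with
  | NConst d k => setN d k
  | NAdd d a b => setN d (N a + N b)%N
  | NSub d a b => setN d (N a - N b)%N
  | NMul d a b => setN d (N a * N b)%N
  | NDiv d a b => setN d (N a %/ N b)%N
  | NLoad d a => setN d (N (N a))
  | NStore d a => setN (N d) (N a)
  | NRandom d a =>
      Move 1 (maxn 1 (N a)) (fun v => Config l.+1 [eta N with d |-> word v] X)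
  | XConst d x => setX d x
  | XAdd d a b => setX d (X a + X b)
  | XSub d a b => setX d (X a - X b)
  | XMul d a b => setX d (X a * X b)
  | XDiv d a b => setX d (X a / X b)
  | XRoot d s k => setX d (nth 0 (rootsR (Poly [seq X i | i <- s])) k)
  | XLoad d a => setX d (X (N a))
  | XStore d a => setX (N d) (X a)
  | XOfN d a => setX d (N a)%:R
  | XInput d a k => setX d (inp (N a) k)
  | Decide d a =>
      Move D.+1 1 (fun=> Config l.+1 [eta N with d |-> word (decide (X a))] X)
  | JumpN a b l' => go (if (N a <= N b)%N then l' else l.+1) N X
  | JumpX a b l' => go (if X a <= X b then l' else l.+1) N X
  | Halt a b =>
      Stop (half_open_itv (if a is Some i then (X i)%:E else -oo%E)
                          (if b is Some i then (X i)%:E else +oo%E))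
  end.

Definition init : config R :=
  Config 0 [eta (fun=> 0%N) with 0%N |-> n, 1%N |-> L] (fun=> 0).

Definition average (m : nat) (f : nat -> R) : R := (\sum_(v < m) f v) / m%:R.

(* Probability of stopping within k steps with a result in Q. *)
Fixpoint stop_prob (Q : set (set R)) (k : nat) (c : config R) : R :=
  match step c, k with
  | Stop J, _ => (`[< Q J >] : nat)%:R
  | Move _ _ _, 0 => 0
  | Move _ m f, k'.+1 => average m (fun v => stop_prob Q k' (f v))
  end.

(* Expected cost of the first k steps. *)
Fixpoint mean_cost (k : nat) (c : config R) : R :=
  match step c, k with
  | Stop _, _ => 0
  | Move _ _ _, 0 => 0
  | Move w m f, k'.+1 => w%:R + average m (fun v => mean_cost k' (f v))
  end.

(* Both sequences are nondecreasing in k: the suprema are the limits. *)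
Definition output_prob (Q : set (set R)) : \bar R :=
  ereal_sup (range (fun k => (stop_prob Q k init)%:E)).

Definition expected_time : \bar R :=
  ereal_sup (range (fun k => (mean_cost k init)%:E)).

End Semantics.

(* Parameter k of object i, extended by 0 outside the input. *)
Definition input (R : realType) (n t : nat) (S : 'I_n -> 'rV[R]_t)
    (i k : nat) : R :=
  if insub i is Some i' then nth 0 (coords (S i')) k else 0.

(* Main.v *)
(* Since n <= L, the time bound is at least n^2 / L, so plain random sampling is
   enough.  Where a predicate of constant complexity first becomes true, one of
   its finitely many polynomials has a root, so every critical value is one of
   boundedly many roots attached to a pair of objects.  Draw O((n^2 / L) log n)
   random roots and keep the smallest interval ]a, b] between drawn values that
   contains the optimum, calling the decision procedure only on values drawn
   inside the current interval.
   - If u values remain between a and the optimum, a draw among them leaves a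
     uniformly chosen number of at most u - 1 of them; the harmonic number H_u
     therefore bounds the expected number of further calls on this side, and
     O(log n) calls are expected in total.
   - More than L critical values survive only if no draw hit the L/2 values
     closest to the optimum on one of its two sides, which is unlikely. *)
Require Import Defs.
From HB Require Import structures.
From mathcomp Require Import all_boot all_order all_algebra.
From mathcomp Require Import all_classical all_reals all_analysis.
From mathcomp Require Import polyrcf ordered_qelim.
From mathcomp Require Import ring lra zify.

Set Implicit Arguments.
Unset Strict Implicit.
Unset Printing Implicit Defensive.

Import Order.TTheory GRing.Theory Num.Theory.

Local Open Scope classical_set_scope.
Local Open Scope ring_scope.

(** * Ranks in a finite set and harmonic sums *)

(** Induction on the cardinality, removing an element of minimal value: its own rank is less than
    the cardinality, and it lies strictly above nothing, so the ranks of the others do not change.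
    Ties only lower ranks, which is why monotonicity of [h] gives an inequality. *)
Lemma sum_rank_le (R : realDomainType) (I : finType) (val : I -> R)
    (h : nat -> R) (A : {set I}) :
  {homo h : i j / (i <= j)%N >-> i <= j} ->
  \sum_(x in A) h #|[set y in A | val x < val y]| <= \sum_(j < #|A|) h j.
Proof.
move=> h_homo; move cardA: #|A| => k; elim: k A cardA => [|k IHk] A cardA.
  move/eqP: cardA; rewrite cards_eq0 => /eqP ->.
  by rewrite big_ord0 big1 // => x; rewrite inE.
have /card_gt0P[x0 x0A] : (0 < #|A|)%N by rewrite cardA.
pose x := [arg min_(i < x0 in A) val i]%O.
have [xA xmin] : x \in A /\ forall y, y \in A -> val x <= val y.
  by rewrite /x; case: arg_minP.
have cardAx : #|A :\ x| = k by move: cardA; rewrite (cardsD1 x) xA => -[].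
rewrite (big_setD1 x) //= big_ord_recr /= addrC lerD //.
  rewrite (le_trans _ (IHk _ cardAx)) // ler_sum // => y /setD1P[_ yA].
  rewrite h_homo // subset_leq_card //; apply/fintype.subsetP => z.
  rewrite !inE => /andP[zA yz]; rewrite zA yz !andbT.
  by apply: contraTneq yz => ->; rewrite -leNgt xmin.
rewrite h_homo // -cardAx subset_leq_card //; apply/fintype.subsetP => z.
rewrite !inE => /andP[zA xz]; rewrite zA !andbT.
by apply: contraTneq xz => ->; rewrite ltxx.
Qed.

Definition harmonic_sum (R : realFieldType) (n : nat) : R := \sum_(i < n) i.+1%:R^-1.

Lemma harmonic_sumS (R : realFieldType) n :
  harmonic_sum R n.+1 = harmonic_sum R n + n.+1%:R^-1.
Proof. by rewrite /harmonic_sum big_ord_recr. Qed.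

Lemma harmonic_sum_homo (R : realFieldType) :
  {homo harmonic_sum R : i j / (i <= j)%N >-> i <= j}.
Proof.
apply: homo_leq => //; first exact: le_trans.
by move=> i; rewrite harmonic_sumS lerDl invr_ge0 ler0n.
Qed.

Lemma harmonic_sum_ge0 (R : realFieldType) n : 0 <= harmonic_sum R n.
Proof. by rewrite sumr_ge0 // => i _; rewrite invr_ge0 ler0n. Qed.

(** This makes the harmonic number the right potential: with [u] values left out of [N],
    [(N - u) * H_u] plus this sum is [N * H_u - u], and the loss [u] is [N] times the probability of
    a hit. *)
Lemma sum_harmonic_sum (R : realFieldType) n :
  \sum_(j < n) harmonic_sum R j = n%:R * harmonic_sum R n - n%:R.
Proof.
elim: n => [|n IHn]; first by rewrite big_ord0 mul0r subr0.
rewrite big_ord_recr /= IHn harmonic_sumS.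
have : n.+1%:R != 0 :> R by rewrite pnatr_eq0.
rewrite -natr1 => ?; field.
by [].
Qed.

(** Doubling the range adds [2 ^ k] terms, each at most the inverse of [2 ^ k]. *)
Lemma harmonic_sum_expn2 (R : realFieldType) k : harmonic_sum R (2 ^ k) <= k.+1%:R.
Proof.
elim: k => [|k IHk]; first by rewrite /harmonic_sum big_ord1 invr1.
rewrite expnS mul2n -addnn /harmonic_sum big_split_ord /= -[k.+2%:R]natr1 lerD //.
apply: (@le_trans _ _ (\sum_(i < 2 ^ k) (2 ^ k)%:R^-1)).
  apply: ler_sum => i _; rewrite lef_pV2 ?posrE ?ltr0n ?expn_gt0 //.
  by rewrite ler_nat -addnS leq_addr.
by rewrite sumr_const card_ord -[leLHS]mulr_natr mulVf // pnatr_eq0 expn_eq0.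
Qed.

(** * Atoms of a formula as polynomials in the growth parameter *)

(** Coefficients stay symbolic in the parameters of the two objects, because the program text has to
    be produced from the formula alone. The boolean selects the second object. *)
Inductive cexpr (R : Type) : Type :=
| CConst of R
| CParam of bool & nat
| CAdd of cexpr R & cexpr R
| CMul of cexpr R & cexpr R.
Arguments CParam {R}.

HB.instance Definition _ (R : Type) := gen_eqMixin (cexpr R).

Section Atoms.
Variables (R : realType) (E : bool -> nat -> R).

Fixpoint ceval (e : cexpr R) : R :=
  match e with
  | CConst x => x
  | CParam b k => E b k
  | CAdd a b => ceval a + ceval b
  | CMul a b => ceval a * ceval b
  end.

Definition peval (s : seq (cexpr R)) : {poly R} := Poly [seq ceval e | e <- s].

Definition slot_value (sl : seq (cexpr R) * nat) : R :=
  nth 0 (rootsR (peval sl.1)) sl.2.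

End Atoms.

Section Compile.
Variables (R : realType) (t : nat).

Fixpoint padd (a b : seq (cexpr R)) : seq (cexpr R) :=
  match a, b with
  | [::], _ => b
  | _, [::] => a
  | x :: a', y :: b' => CAdd x y :: padd a' b'
  end.

Definition pscale (x : cexpr R) (b : seq (cexpr R)) := [seq CMul x y | y <- b].

Fixpoint pmul (a b : seq (cexpr R)) : seq (cexpr R) :=
  if a is x :: a' then padd (pscale x b) (CConst 0 :: pmul a' b) else [::].

(** The growth parameter is variable [t + t], whence the polynomial [[:: CConst 0; CConst 1]].
    Variables beyond it read the default 0 of the environment. *)
Fixpoint term_poly (tm : GRing.term R) : seq (cexpr R) :=
  match tm with
  | GRing.Var k =>
      if (k < t)%N then [:: CParam false k]
      else if (k < t + t)%N then [:: CParam true (k - t)]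
      else if k == (t + t)%N then [:: CConst 0; CConst 1] else [::]
  | GRing.Const x => [:: CConst x]
  | GRing.NatConst n => [:: CConst n%:R]
  | GRing.Add a b => padd (term_poly a) (term_poly b)
  | GRing.Opp a => pscale (CConst (-1)) (term_poly a)
  | GRing.NatMul a n => pscale (CConst n%:R) (term_poly a)
  | GRing.Mul a b => pmul (term_poly a) (term_poly b)
  | GRing.Inv _ => [::]
  | GRing.Exp a n => iter n (pmul (term_poly a)) [:: CConst 1]
  end.

Definition atom_poly (a b : GRing.term R) :=
  padd (term_poly a) (pscale (CConst (-1)) (term_poly b)).

Fixpoint atoms (f : ord.formula R) : seq (seq (cexpr R)) :=
  match f with
  | ord.Equal a b | ord.Lt a b | ord.Le a b => [:: atom_poly a b]
  | ord.And f g | ord.Or f g | ord.Implies f g => atoms f ++ atoms g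
  | ord.Not f => atoms f
  | _ => [::]
  end.

(* The dummy first slot makes the list nonempty, so that a slot can be drawn. *)
Definition slots (f : ord.formula R) : seq (seq (cexpr R) * nat) :=
  ([::], 0%N) :: [seq (a, k) | a <- atoms f, k <- iota 0 (size a)].

Section Eval.
Variable E : bool -> nat -> R.

Lemma peval_cons x s : peval E (x :: s) = peval E s * 'X + (ceval E x)%:P.
Proof. by rewrite /peval /= cons_poly_def. Qed.

Lemma peval_nil : peval E [::] = 0.
Proof. by []. Qed.

Lemma pevalD a b : peval E (padd a b) = peval E a + peval E b.
Proof.
elim: a b => [|x a IHa] [|y b] //=; rewrite ?peval_nil ?add0r ?addr0 //.
by rewrite !peval_cons IHa /= polyCD; ring.
Qed.

Lemma pevalZ x b : peval E (pscale x b) = (ceval E x)%:P * peval E b.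
Proof.
elim: b => [|y b IHb] /=; first by rewrite peval_nil mulr0.
by rewrite !peval_cons IHb /= polyCM; ring.
Qed.

Lemma pevalM a b : peval E (pmul a b) = peval E a * peval E b.
Proof.
elim: a => [|x a IHa]; first by rewrite peval_nil mul0r.
rewrite /= -/(pscale x b) pevalD pevalZ !peval_cons IHa /= polyC0; ring.
Qed.

End Eval.

Variables p q : 'rV[R]_t.

Definition pair_params (b : bool) : nat -> R := nth 0 (coords (if b then q else p)).

Lemma size_coords m (x : 'rV[R]_m) : size (coords x) = m.
Proof. by rewrite size_map size_enum_ord. Qed.

Lemma term_polyP tm r : GRing.rterm tm ->
  (peval pair_params (term_poly tm)).[r] =
  GRing.eval (coords p ++ coords q ++ [:: r]) tm.
Proof.
elim: tm => //=.
- move=> k _; rewrite !nth_cat !size_coords.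
  case: ltnP => [ltkt|lekt].
    by rewrite !peval_cons peval_nil mul0r add0r hornerC.
  rewrite ltn_subLR //; case: ltnP => [ltk|lek].
    by rewrite !peval_cons peval_nil mul0r add0r hornerC.
  case: eqP => [->|/eqP nek].
    by rewrite !peval_cons peval_nil /= !hornerE addnK subnn.
  rewrite peval_nil horner0 nth_default //= subn_gt0 ltn_subRL.
  by rewrite ltn_neqAle eq_sym nek.
- by move=> x _; rewrite !peval_cons peval_nil mul0r add0r hornerC.
- by move=> x _; rewrite !peval_cons peval_nil mul0r add0r hornerC.
- by move=> a IHa b IHb /andP[/IHa <- /IHb <-]; rewrite pevalD hornerD.
- by move=> a IHa /IHa <-; rewrite pevalZ hornerM hornerC mulN1r.
- by move=> a IHa n /IHa <-; rewrite pevalZ hornerM hornerC mulr_natl.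
- by move=> a IHa b IHb /andP[/IHa <- /IHb <-]; rewrite pevalM hornerM.
- move=> a IHa n /IHa <-; elim: n => [|n IHn] /=.
    by rewrite !peval_cons peval_nil mul0r add0r hornerC expr0.
  by rewrite pevalM hornerM IHn exprS.
Qed.

Lemma atom_polyP a b r : GRing.rterm a -> GRing.rterm b ->
  let e := coords p ++ coords q ++ [:: r] in
  (peval pair_params (atom_poly a b)).[r] = GRing.eval e a - GRing.eval e b.
Proof.
by move=> ra rb /=; rewrite pevalD pevalZ hornerD hornerM hornerC !term_polyP // mulN1r.
Qed.

End Compile.

(** * Critical values as roots of atoms *)

Lemma sgr_left_const (R : rcfType) (P : {poly R}) (x : R) :
  (P != 0 -> ~~ root P x) ->
  exists2 e, 0 < e & forall y, x - e < y <= x -> Num.sg P.[y] = Num.sg P.[x].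
Proof.
have [-> _|P0 /(_ isT)] := eqVneq P 0.
  by exists 1 => // y _; rewrite !horner0.
rewrite rootE => Px0.
have [|e e_gt0 Pe] := poly_cont x P (e := `|P.[x]|); first by rewrite normr_gt0.
exists e => // y /andP[ltxy leyx].
have {Pe}: `|P.[y] - P.[x]| < `|P.[x]|.
  by apply: Pe; rewrite ler0_norm ?subr_le0 // opprB ltrBlDr -ltrBlDl.
have [Px|Px|Px] := ltrgtP P.[x] 0; last by rewrite Px eqxx in Px0.
  by rewrite (ltr0_norm Px) ltr_norml => /andP[_ ?]; rewrite !ltr0_sg //; lra.
by rewrite (gtr0_norm Px) ltr_norml => /andP[? _]; rewrite !gtr0_sg //; lra.
Qed.

Section Critical.
Variables (R : realType) (t : nat) (p q : 'rV[R]_t).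

Let env r := coords p ++ coords q ++ [:: r].
Let ev := peval (pair_params p q).

(** The truth of a quantifier-free formula depends only on the signs of its atoms, and these are
    constant just to the left of a point where no nonzero atom vanishes. *)
Lemma holds_left_const f x : ord.qf_form f -> ord.rformula f ->
    (forall a, a \in atoms t f -> ev a != 0 -> ~~ root (ev a) x) ->
  exists2 e, 0 < e &
    forall y, x - e < y <= x -> (ord.holds (env y) f <-> ord.holds (env x) f).
Proof.
have atomic a b : GRing.rterm a -> GRing.rterm b ->
    (forall s, s \in [:: atom_poly t a b] -> ev s != 0 -> ~~ root (ev s) x) ->
  exists2 e, 0 < e & forall y, x - e < y <= x ->
    Num.sg (GRing.eval (env y) a - GRing.eval (env y) b) =
    Num.sg (GRing.eval (env x) a - GRing.eval (env x) b).
  move=> ra rb /(_ _ (mem_head _ _)) /sgr_left_const[e e0 he].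
  by exists e => // y /he; rewrite /ev !atom_polyP.
(* Abstracting the connective treats conjunction, disjunction and implication at once, with the
   smaller of the two radii. *)
have binary f1 f2 (op : Prop -> Prop -> Prop) :
    (forall P P' Q Q', (P <-> P') -> (Q <-> Q') -> (op P Q <-> op P' Q')) ->
    (exists2 e, 0 < e & forall y, x - e < y <= x ->
      (ord.holds (env y) f1 <-> ord.holds (env x) f1)) ->
    (exists2 e, 0 < e & forall y, x - e < y <= x ->
      (ord.holds (env y) f2 <-> ord.holds (env x) f2)) ->
  exists2 e, 0 < e & forall y, x - e < y <= x ->
    (op (ord.holds (env y) f1) (ord.holds (env y) f2) <->
     op (ord.holds (env x) f1) (ord.holds (env x) f2)).
  move=> opP [e1 e10 h1] [e2 e20 h2]; exists (Num.min e1 e2).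
    by rewrite lt_min e10.
  move=> y /andP[ltxy leyx]; apply: opP; [apply: h1|apply: h2];
    rewrite leyx andbT (le_lt_trans _ ltxy) // lerB // ge_min lexx ?orbT //.
have catP (s1 s2 : seq (seq (cexpr R))) :
    (forall a, a \in s1 ++ s2 -> ev a != 0 -> ~~ root (ev a) x) ->
    (forall a, a \in s1 -> ev a != 0 -> ~~ root (ev a) x) /\
    (forall a, a \in s2 -> ev a != 0 -> ~~ root (ev a) x).
  by move=> h; split=> a ain; apply: h; rewrite mem_cat ain ?orbT.
elim: f => //=.
- by move=> b _ _ _; exists 1.
- move=> a b _ /andP[ra rb] /(atomic _ _ ra rb)[e e0 he]; exists e => // y /he heq.
  split=> h; apply/eqP; rewrite -subr_eq0 -sgr_eq0.
    by rewrite -heq h subrr sgr0.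
  by rewrite heq h subrr sgr0.
- move=> a b _ /andP[ra rb] /(atomic _ _ ra rb)[e e0 he]; exists e => // y /he heq.
  by rewrite -subr_lt0 -sgr_lt0 heq sgr_lt0 subr_lt0.
- move=> a b _ /andP[ra rb] /(atomic _ _ ra rb)[e e0 he]; exists e => // y /he heq.
  by rewrite -subr_le0 -sgr_le0 heq sgr_le0 subr_le0.
- move=> f1 IH1 f2 IH2 /andP[q1 q2] /andP[r1 r2] /catP[h1 h2].
  by apply: binary; [tauto|exact: IH1|exact: IH2].
- move=> f1 IH1 f2 IH2 /andP[q1 q2] /andP[r1 r2] /catP[h1 h2].
  by apply: binary; [tauto|exact: IH1|exact: IH2].
- move=> f1 IH1 f2 IH2 /andP[q1 q2] /andP[r1 r2] /catP[h1 h2].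
  by apply: (binary f1 f2 (fun P Q => P -> Q)); [tauto|exact: IH1|exact: IH2].
- move=> f1 IH1 q1 r1 h1; have [e e0 he] := IH1 q1 r1 h1.
  by exists e => // y /he ->.
Qed.

(** If no nonzero atom vanished at [x], the formula would already hold slightly to the left of [x],
    against minimality. So [x] is a root of some atom, and its index among the sorted roots gives
    the slot. *)
Lemma minimum_is_slot f x : semialgebraic_formula f ->
    is_minimum [set r | ord.holds (env r) f] x ->
  exists2 s, (s < size (slots t f))%N &
    x = slot_value (pair_params p q) (nth ([::], 0%N) (slots t f) s).
Proof.
move=> [qf rf] [fx lbx].
have [/existsNP[a /not_implyP[ain /not_implyP[a0 /negP/negPn ra]]]|] :=
    pselect (~ forall a, a \in atoms t f -> ev a != 0 -> ~~ root (ev a) x).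
  have xin : x \in rootsR (ev a).
    by rewrite -(roots_on_rootsR a0) in_itv /= ra.
  have slin : (a, index x (rootsR (ev a))) \in slots t f.
    rewrite inE; apply/orP; right; apply/allpairsPdep.
    exists a, (index x (rootsR (ev a))); split=> //.
    (* A nonzero polynomial has fewer roots than coefficients, so the index is one of those listed
       in [slots]. *)
    rewrite mem_iota add0n -(size_map (ceval (pair_params p q))).
    rewrite (leq_trans _ (size_Poly _)) //.
    apply: leq_trans (@max_poly_roots _ _ (rootsR (ev a)) a0 _ _).
    - by rewrite ltnS ltnW // index_mem.
    - by apply/allP => z; rewrite -(roots_on_rootsR a0) => /andP[].
    - exact: uniq_roots.
  exists (index (a, index x (rootsR (ev a))) (slots t f)).
    by rewrite index_mem.
  by rewrite nth_index // /slot_value /= nth_index.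
move=> /contrapT /(holds_left_const qf rf)[e e0 he].
suff : x <= x - e / 2 by lra.
by apply: lbx; apply/(he _ _).2 => //; lra.
Qed.

End Critical.

(** * Cost and success probability of programs *)

Section Average.
Variable R : realType.

Lemma ler_average m (f g : nat -> R) :
  (forall v, (v < m)%N -> f v <= g v) -> average m f <= average m g.
Proof.
by move=> fg; rewrite ler_wpM2r ?invr_ge0 ?ler0n // ler_sum // => v _; exact: fg.
Qed.

Lemma average_cst m (x : R) : (0 < m)%N -> average m (fun=> x) = x.
Proof.
move=> m0; rewrite /average sumr_const card_ord -[x *+ m]mulr_natr.
by rewrite mulfK // pnatr_eq0 -lt0n.
Qed.

Lemma averageD m (f g : nat -> R) :
  average m (fun v => f v + g v) = average m f + average m g.
Proof. by rewrite /average big_split mulrDl. Qed.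

End Average.

Section Spec.
Variables (R : realType) (M : program R) (n : nat) (inp : nat -> nat -> R).
Variables (opt : R) (D : nat) (Q1 Q2 : set (set R)).

Local Notation step := (step M n inp opt D).
Local Notation stop_prob := (stop_prob M n inp opt D).
Local Notation mean_cost := (mean_cost M n inp opt D).

(** A form of Hoare triple read backwards along the code: [b] is a budget for the expected remaining
    cost, [p] a lower bound on the probability of ending in [Q2]. The probabilities are bounded at
    all large finite horizons, so that no limit has to be taken when specifications are composed. *)
Definition spec (c : config R) (b p : R) : Prop :=
  [/\ forall k, mean_cost k c <= b,
      exists k0, forall k, (k0 <= k)%N -> 1 <= stop_prob Q1 k c
    & exists k0, forall k, (k0 <= k)%N -> p <= stop_prob Q2 k c].

Lemma spec_le c b b' p p' : b <= b' -> p' <= p -> spec c b p -> spec c b' p'.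
Proof.
move=> bb' pp' [cost [k1 h1] [k2 h2]]; split; first by move=> k; exact: le_trans bb'.
  by exists k1.
by exists k2 => k /h2; exact: le_trans.
Qed.

Lemma stop_prob_le1 Q k c : stop_prob Q k c <= 1.
Proof.
elim: k c => [|k IHk] c /=; case: (step c) => [J|w m f].
- by case: asboolP.
- exact: ler01.
- by case: asboolP.
have [->|m0] := posnP m; first by rewrite /average big_ord0 mul0r ler01.
by rewrite -[leRHS](average_cst 1 m0); apply: ler_average => v _; exact: IHk.
Qed.

(** [Q2] is asked for only when [p] is positive: a bound of the form one minus a failure bound may
    be vacuous. *)
Lemma spec_stop c J b p : step c = Stop J -> Q1 J -> 0 <= b ->
  p <= 1 -> (0 < p -> Q2 J) -> spec c b p.
Proof.
move=> sc Q1J b0 p1 Q2J; split.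
- by move=> [|k] /=; rewrite sc.
- by exists 0%N => k _; rewrite (_ : stop_prob _ _ _ = 1) //; case: k => [|k] /=;
    rewrite sc asboolT.
exists 0%N => k _; rewrite (_ : stop_prob _ _ _ = (`[< Q2 J >] : nat)%:R).
  by case: asboolP => // Q2J'; rewrite leNgt; apply/negP => /Q2J.
by case: k => [|k] /=; rewrite sc.
Qed.

(** There are finitely many branches, so the largest of their thresholds serves for all. *)
Lemma eventually_average m (f : nat -> config R) Q (p : nat -> R) :
    (forall v, (v < m)%N ->
       exists k0, forall k, (k0 <= k)%N -> p v <= stop_prob Q k (f v)) ->
  exists k0, forall k, (k0 <= k)%N ->
    average m p <= average m (fun v => stop_prob Q k (f v)).
Proof.
move=> h.
have [K hK] := boolp.choice (fun v : 'I_m => h v (ltn_ord v)).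
exists (\max_v K v)%N => k lek; apply: ler_average => v ltvm.
apply: (hK (Ordinal ltvm)); apply: leq_trans lek.
exact: (leq_bigmax (Ordinal ltvm)).
Qed.

(** Total expectation over the drawn value. Budget and success bound may depend on the draw, which
    lets potentials vary from branch to branch. *)
Lemma spec_move c w m f (bv pv : nat -> R) b p : step c = Move w m f -> (0 < m)%N ->
    (forall v, (v < m)%N -> spec (f v) (bv v) (pv v)) ->
    w%:R + average m bv <= b -> p <= average m pv ->
  spec c b p.
Proof.
move=> sc m0 hf hb hp; have mc v k : (v < m)%N -> mean_cost k (f v) <= bv v.
  by case/hf.
split.
- move=> k; apply: le_trans hb; case: k => [|k] /=; rewrite sc.
    (* Costs at horizon 0 vanish, so the budgets of the branches are nonnegative. *)
    rewrite addr_ge0 // -[leLHS](average_cst 0 m0) ler_average // => v ltvm.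
    by apply: le_trans (mc v 0%N ltvm); rewrite /=; case: (step (f v)).
  by rewrite lerD2l ler_average // => v /mc.
- have [|k0 h] := @eventually_average m f Q1 (fun=> 1); first by move=> v /hf[].
  exists k0.+1 => -[//|k] /h /=; rewrite sc; apply: le_trans.
  by rewrite average_cst.
- have [|k0 h] := @eventually_average m f Q2 pv; first by move=> v /hf[].
  exists k0.+1 => -[//|k] /h /=; rewrite sc; exact: le_trans.
Qed.

Lemma spec_step w c c' b p : step c = Move w 1 (fun=> c') ->
  spec c' (b - w%:R) p -> spec c b p.
Proof.
move=> sc c'P; apply: (spec_move (bv := fun=> b - w%:R) (pv := fun=> p) sc) => //.
  by rewrite average_cst // addrC subrK.
by rewrite average_cst.
Qed.

Lemma spec_output L b p : spec (init R n L) b p ->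
  [/\ output_prob M n L inp opt D Q1 = 1%E,
      (p%:E <= output_prob M n L inp opt D Q2)%E
    & (expected_time M n L inp opt D <= b%:E)%E].
Proof.
move=> [cost [k1 h1] [k2 h2]]; split.
- apply/eqP; rewrite eq_le; apply/andP; split.
    by apply: ge_ereal_sup => _ [k _ <-]; rewrite lee_fin stop_prob_le1.
  apply: (@le_trans _ _ (stop_prob Q1 k1 (init R n L))%:E).
    by rewrite lee_fin h1.
  by apply: ereal_sup_ubound; exists k1.
- apply: (@le_trans _ _ (stop_prob Q2 k2 (init R n L))%:E).
    by rewrite lee_fin h2.
  by apply: ereal_sup_ubound; exists k2.
by apply: ge_ereal_sup => _ [k _ <-]; rewrite lee_fin.
Qed.

End Spec.

(** * Straight-line code computing all slots of a pair *)

Section StraightLine.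
Variable R : realType.

Definition straight (i : instr R) : bool :=
  match i with
  | XConst _ _ | XAdd _ _ _ | XMul _ _ _ | XRoot _ _ _ | XInput _ _ _ => true
  | _ => false
  end.

(* Stack discipline: X[r] is preserved for r < d. The two objects are N[10] and
   N[11]. *)
Fixpoint cexpr_code (e : cexpr R) (d : nat) : seq (instr R) :=
  match e with
  | CConst x => [:: XConst d x]
  | CParam b k => [:: XInput d (if b then 11 else 10) k]
  | CAdd e1 e2 => cexpr_code e1 d ++ cexpr_code e2 d.+1 ++ [:: XAdd d d d.+1]
  | CMul e1 e2 => cexpr_code e1 d ++ cexpr_code e2 d.+1 ++ [:: XMul d d d.+1]
  end.

Fixpoint cexprs_code (s : seq (cexpr R)) (d : nat) : seq (instr R) :=
  if s is e :: s' then cexpr_code e d ++ cexprs_code s' d.+1 else [::].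

(** Coefficients go to a scratch area starting at [base], reused from slot to slot; the roots
    accumulate from [d] on. *)
Fixpoint slots_code (base d : nat) (sl : seq (seq (cexpr R) * nat)) :
    seq (instr R) :=
  if sl is s :: sl' then
    cexprs_code s.1 base ++
      XRoot d (iota base (size s.1)) s.2 :: slots_code base d.+1 sl'
  else [::].

Lemma straight_cexpr e d : all straight (cexpr_code e d).
Proof. by elim: e d => //= a IHa b IHb d; rewrite !all_cat IHa IHb. Qed.

Lemma straight_slots base d sl : all straight (slots_code base d sl).
Proof.
elim: sl d => //= -[s k] sl IHsl d; rewrite all_cat /= IHsl andbT /=.
by elim: s base {IHsl} => //= e s IHs base; rewrite all_cat straight_cexpr IHs.
Qed.

Variables (inp : nat -> nat -> R) (N : nat -> nat).

Definition exec1 (X : nat -> R) (i : instr R) : nat -> R :=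
  match i with
  | XConst d x => [eta X with d |-> x]
  | XAdd d a b => [eta X with d |-> X a + X b]
  | XMul d a b => [eta X with d |-> X a * X b]
  | XRoot d s k => [eta X with d |-> nth 0 (rootsR (Poly [seq X i | i <- s])) k]
  | XInput d a k => [eta X with d |-> inp (N a) k]
  | _ => X
  end.

Definition exec := foldl exec1.

Lemma exec_cat X s1 s2 : exec X (s1 ++ s2) = exec (exec X s1) s2.
Proof. exact: foldl_cat. Qed.

Let E b := inp (N (if b then 11 else 10)).

Lemma exec_cexpr e d X : exec X (cexpr_code e d) d = ceval E e /\
  forall r, (r < d)%N -> exec X (cexpr_code e d) r = X r.
Proof.
elim: e d X => [x|b k|e1 IH1 e2 IH2|e1 IH1 e2 IH2] d X /=.
- by rewrite eqxx; split=> // r /ltn_eqF ->.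
- by rewrite eqxx; split=> // r /ltn_eqF ->; case: b.
- rewrite !exec_cat /= eqxx; have [h1 h1'] := IH1 d X.
  have [h2 h2'] := IH2 d.+1 (exec X (cexpr_code e1 d)).
  split; first by rewrite h2 h2' ?h1.
  by move=> r ltrd; rewrite ltn_eqF // h2' ?h1' // ltnW.
- rewrite !exec_cat /= eqxx; have [h1 h1'] := IH1 d X.
  have [h2 h2'] := IH2 d.+1 (exec X (cexpr_code e1 d)).
  split; first by rewrite h2 h2' ?h1.
  by move=> r ltrd; rewrite ltn_eqF // h2' ?h1' // ltnW.
Qed.

Lemma exec_cexprs s d X :
  [seq exec X (cexprs_code s d) r | r <- iota d (size s)] = [seq ceval E e | e <- s] /\
  forall r, (r < d)%N -> exec X (cexprs_code s d) r = X r.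
Proof.
elim: s d X => //= e s IHs d X; rewrite !exec_cat.
have [h1 h1'] := exec_cexpr e d X.
have [h2 h2'] := IHs d.+1 (exec X (cexpr_code e d)).
split; first by rewrite h2 h2' ?h1.
by move=> r ltrd; rewrite h2' ?h1' // ltnW.
Qed.

(** The hypothesis keeps the registers of results below the scratch area, so that computing a slot
    does not overwrite the earlier ones. *)
Lemma exec_slots base d sl X : (d + size sl <= base)%N ->
  (forall i, (i < size sl)%N -> exec X (slots_code base d sl) (d + i) =
     slot_value E (nth ([::], 0%N) sl i)) /\
  forall r, (r < d)%N -> exec X (slots_code base d sl) r = X r.
Proof.
elim: sl d X => //= -[s k] sl IHsl d X /=; rewrite addnS => led.
rewrite exec_cat /=.
set Y := exec X (cexprs_code s base).
have [hY hY'] := exec_cexprs s base X.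
set Z := (X in exec X _).
have [h h'] := IHsl d.+1 Z led.
split.
  move=> [_|i lti]; last by rewrite addnS -addSn h.
  by rewrite addn0 h' // /Z /= eqxx /slot_value /peval -hY.
move=> r ltrd; rewrite h'; last exact: ltnW.
rewrite /Z /= ltn_eqF // /Y hY' //; lia.
Qed.

End StraightLine.

Lemma spec_straight (R : realType) (M : program R) n inp opt D Q1 Q2 s l N X b p :
    (forall i, (i < size s)%N ->
       nth (Halt None None) (Defs.code M) (l + i) = nth (Halt None None) s i) ->
    all (@straight R) s ->
    spec M n inp opt D Q1 Q2 (Config (l + size s) N (exec inp N X s))
      (b - (size s)%:R) p ->
  spec M n inp opt D Q1 Q2 (Config l N X) b p.
Proof.
elim: s l X b => [|i s IHs] l X b /= codeM; first by rewrite addn0 subr0.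
move=> /andP[si ss] h.
have {}h : spec M n inp opt D Q1 Q2 (Config l.+1 N (exec1 inp N X i)) (b - 1) p.
  apply: IHs => //; first by move=> j ltj; rewrite addSnnS codeM.
  by rewrite addSnnS -addrA -opprD -natr1 addrC [1 + _]addrC in h *; rewrite addrC.
apply: (spec_step (w := 1) _ h).
have := codeM 0%N isT; rewrite addn0 /= => ->.
by case: i si {codeM h}.
Qed.

(** * One random draw *)

Section Sampling.
Variables (R : realType) (I : finType) (val : I -> R) (opt : R).

(** Values are counted with multiplicity, as elements of the sample space. A value equal to the
    optimum belongs to the upper side, in accordance with []a, b]]. *)
Definition below (a : \bar R) : {set I} :=
  [set x | (a < (val x)%:E)%E && (val x < opt)].
Definition above (b : \bar R) : {set I} :=
  [set x | (opt <= val x) && ((val x)%:E < b)%E].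

Definition hit (a b : \bar R) (v : R) : bool := (a < v%:E)%E && (v%:E < b)%E.
Definition next_lo (a b : \bar R) (v : R) : \bar R :=
  if hit a b v && (v < opt) then v%:E else a.
Definition next_hi (a b : \bar R) (v : R) : \bar R :=
  if hit a b v && (opt <= v) then v%:E else b.

Variables (a b : \bar R).
Hypotheses (a_lt : (a < opt%:E)%E) (le_b : (opt%:E <= b)%E).

Lemma next_lo_lt v : (next_lo a b v < opt%:E)%E.
Proof. by rewrite /next_lo; case: ifP => // /andP[_]; rewrite lte_fin. Qed.

Lemma le_next_hi v : (opt%:E <= next_hi a b v)%E.
Proof. by rewrite /next_hi; case: ifP => // /andP[_]; rewrite lee_fin. Qed.

Lemma hit_below x : x \in below a -> hit a b (val x).
Proof.
rewrite inE => /andP[ax xo]; rewrite /hit ax /= (lt_le_trans _ le_b) //.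
Qed.

Lemma hit_above x : x \in above b -> hit a b (val x).
Proof.
by rewrite inE => /andP[xo xb]; rewrite /hit xb andbT (lt_le_trans a_lt).
Qed.

Lemma card_hit : (\sum_x hit a b (val x))%N = (#|below a| + #|above b|)%N.
Proof.
rewrite -!sum1_card [X in (_ = X + _)%N]big_mkcond.
rewrite [X in (_ = _ + X)%N]big_mkcond -big_split /=.
apply: eq_bigr => x _; rewrite !inE /hit.
case: (ltP (val x) opt) => xo; rewrite ?andbT ?andbF ?addn0 ?add0n /=.
  by rewrite (lt_le_trans _ le_b) ?lte_fin // andbT; case: (a < _)%E.
by rewrite (lt_le_trans a_lt) ?lee_fin //; case: (_ < b)%E.
Qed.

Variable h : nat -> R.
Hypothesis h_homo : {homo h : i j / (i <= j)%N >-> i <= j}.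

(** A draw outside [below a] leaves the lower end in place. A draw inside moves it to the drawn
    value, and what remains is the rank of that value, so [sum_rank_le] applies. *)
Lemma sum_below_next :
  \sum_x h #|below (next_lo a b (val x))| <=
  (#|I| - #|below a|)%:R * h #|below a| + \sum_(j < #|below a|) h j.
Proof.
rewrite (bigID (mem (below a))) /= addrC lerD //.
  rewrite (eq_bigr (fun=> h #|below a|)) => [|x]; last first.
    rewrite inE /next_lo /hit; case: (a < _)%E => //=.
    by rewrite -leNgt => xo; rewrite [val x < opt]ltNge xo andbF.
  by rewrite sumr_const -(cardC (mem (below a))) addKn mulr_natl.
apply: le_trans (sum_rank_le val (below a) h_homo).
apply: ler_sum => x xa; apply: h_homo; apply: subset_leq_card.
apply/fintype.subsetP => y; rewrite /next_lo hit_below //=.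
move: xa; rewrite !inE => /andP[ax xo]; rewrite xo lte_fin.
by move=> /andP[xy ->]; rewrite xy !andbT (lt_trans ax) ?lte_fin.
Qed.

Lemma sum_above_next :
  \sum_x h #|above (next_hi a b (val x))| <=
  (#|I| - #|above b|)%:R * h #|above b| + \sum_(j < #|above b|) h j.
Proof.
rewrite (bigID (mem (above b))) /= addrC lerD //.
  rewrite (eq_bigr (fun=> h #|above b|)) => [|x]; last first.
    rewrite inE /next_hi /hit; case: (opt <= _) => /=; last by rewrite andbF.
    by move=> /negbTE ->; rewrite andbF.
  by rewrite sumr_const -(cardC (mem (above b))) addKn mulr_natl.
(* Negating the values turns the upper side into the situation of [sum_rank_le]. *)
apply: le_trans (sum_rank_le (fun x => - val x) (above b) h_homo).
apply: ler_sum => x xa; apply: h_homo; apply: subset_leq_card.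
apply/fintype.subsetP => y; rewrite /next_hi hit_above //=.
move: xa; rewrite !inE => /andP[xo xb]; rewrite xo lte_fin ltrN2.
by move=> /andP[-> xy]; rewrite xy andbT /= (lt_trans _ xb) ?lte_fin.
Qed.

End Sampling.

(** * Potentials for the decision calls and for the failure probability *)

Section Potentials.
Variables (R : realType) (I : finType) (val : I -> R) (opt : R).
Variables (a b : \bar R).
Hypotheses (a_lt : (a < opt%:E)%E) (le_b : (opt%:E <= b)%E).

(* Bounds the expected number of further hits. *)
Definition calls (a b : \bar R) : R :=
  harmonic_sum R #|below val opt a| + harmonic_sum R #|above val opt b|.

Lemma calls_ge0 a' b' : 0 <= calls a' b'.
Proof. by rewrite addr_ge0 ?harmonic_sum_ge0. Qed.

(** On each side [sum_harmonic_sum] yields a loss equal to the number of values left there; by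
    [card_hit] the two losses add up to the number of hits, which pays for the calls. *)
Lemma sum_calls_next :
  \sum_x ((hit a b (val x) : nat)%:R +
          calls (next_lo opt a b (val x)) (next_hi opt a b (val x))) <=
  #|I|%:R * calls a b.
Proof.
rewrite /calls !big_split /= -natr_sum (card_hit val a_lt le_b) natrD.
have := sum_below_next val a le_b (@harmonic_sum_homo R).
have := sum_above_next val b a_lt (@harmonic_sum_homo R).
rewrite !sum_harmonic_sum !natrB ?max_card //.
set u := #|below _ _ _|%:R; set w := #|above _ _ _|%:R; set N := #|_|%:R; nra.
Qed.

Variable s : nat.
Hypothesis s_le : (s <= #|I|)%N.

(* Bounds the probability that none of [k] samples reaches the [s] values that
   are closest to the optimum on a side where [u] values remain. *)
Definition miss (k u : nat) : R :=
  if (s <= u)%N then (1 - s%:R / #|I|%:R) ^+ k else 0.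

Lemma miss_base_ge0 : 0 <= 1 - s%:R / #|I|%:R :> R.
Proof.
rewrite subr_ge0; have [I0|I0] := posnP #|I|.
  by rewrite I0 invr0 mulr0 ler01.
by rewrite ler_pdivrMr ?ltr0n // mul1r ler_nat.
Qed.

Lemma miss_ge0 k u : 0 <= miss k u.
Proof. by rewrite /miss; case: ifP => // _; rewrite exprn_ge0 // miss_base_ge0. Qed.

Lemma miss_homo k : {homo miss k : i j / (i <= j)%N >-> i <= j}.
Proof.
move=> i j ij; rewrite /miss; case: leqP => [si|_].
  by rewrite (leq_trans si ij).
exact: miss_ge0.
Qed.

(** For [s <= u], the weights on the left add up to [(N - u) + (u - s) = N - s] with [N] the size of
    the sample space, which is the factor [1 - s / N] of one more draw. For [u < s] the left side
    vanishes. *)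
Lemma sum_miss k u : (u <= #|I|)%N ->
  (#|I| - u)%:R * miss k u + \sum_(j < u) miss k j <= #|I|%:R * miss k.+1 u.
Proof.
move=> uI; rewrite {1 3}/miss; case: leqP => [su|us]; last first.
  rewrite !mulr0 add0r big1 // => j _; rewrite /miss leqNgt.
  by rewrite (leq_trans (ltn_ord j) (ltnW us)).
have -> : \sum_(j < u) miss k j = (u - s)%:R * (1 - s%:R / #|I|%:R) ^+ k.
  rewrite -(big_mkord xpredT (miss k)) (@big_cat_nat _ _ _ s) //=.
  rewrite [X in X + _]big_nat_cond big1 ?add0r => [|j /andP[/andP[_ js] _]]; last first.
    by rewrite /miss leqNgt js.
  rewrite (eq_big_nat _ _ (F2 := fun=> (1 - s%:R / #|I|%:R) ^+ k)) => [|j /andP[sj _]].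
    by rewrite sumr_const_nat [RHS]mulr_natl.
  by rewrite /miss sj.
rewrite -mulrDl -natrD exprS mulrA ler_wpM2r ?exprn_ge0 ?miss_base_ge0 //.
have -> : (#|I| - u + (u - s) = #|I| - s)%N by lia.
have [I0|I0] := posnP #|I|; first by rewrite I0 sub0n mul0r.
by rewrite natrB // mulrBr mulr1 mulrCA mulfV ?mulr1 // pnatr_eq0 -lt0n.
Qed.

(** A union bound over the two sides. *)
Definition fail k a' b' := miss k #|below val opt a'| + miss k #|above val opt b'|.

Lemma sum_fail_next k :
  \sum_x fail k (next_lo opt a b (val x)) (next_hi opt a b (val x)) <=
  #|I|%:R * fail k.+1 a b.
Proof.
rewrite /fail big_split /= mulrDr lerD //.
  exact: le_trans (sum_below_next val a le_b (@miss_homo k)) (sum_miss _ (max_card _)).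
exact: le_trans (sum_above_next val b a_lt (@miss_homo k)) (sum_miss _ (max_card _)).
Qed.

(** With no draw left, each [miss] is 0 or 1, so a sum below 1 forces both to be 0. *)
Lemma fail_lt1 a' b' : fail 0 a' b' < 1 ->
  (#|below val opt a'| < s)%N /\ (#|above val opt b'| < s)%N.
Proof.
rewrite /fail /miss !expr0 => h; rewrite !ltnNge; split; apply/negP => hs;
  move: h; rewrite hs; case: ifP => _; lra.
Qed.

End Potentials.

(** * Amplification, and counting the critical values of an interval *)

(** By Bernoulli, [2 <= 1 + u * q <= (1 + q) ^ u], while [(1 - q) ^ u * (1 + q) ^ u <= 1]; so each
    block of [u] factors is at most one half. *)
Lemma half_power (R : realFieldType) (q : R) (u w : nat) :
  0 <= q <= 1 -> 1 <= u%:R * q -> (1 - q) ^+ (u * w) <= (2 ^ w)%:R^-1.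
Proof.
move=> /andP[q0 q1] uq.
have bern k : 1 + k%:R * q <= (1 + q) ^+ k.
  elim: k => [|k IHk]; first by rewrite mul0r addr0.
  rewrite exprS; apply: le_trans (_ : (1 + q) * (1 + k%:R * q) <= _); last first.
    by rewrite ler_wpM2l // addr_ge0.
  by rewrite -natr1; have : 0 <= k%:R :> R := ler0n _ _; nra.
have h2 : (1 - q) ^+ u <= 2^-1.
  rewrite -[leRHS]mul1r ler_pdivlMr //.
  have : (1 - q) ^+ u * 2 <= ((1 - q) * (1 + q)) ^+ u.
    rewrite exprMn ler_wpM2l ?exprn_ge0 ?subr_ge0 //.
    by apply: le_trans (bern u); lra.
  by move=> /le_trans; apply; rewrite exprn_ile1 //; nra.
rewrite exprM natrX -exprVn lerXn2r // nnegrE ?invr_ge0 // exprn_ge0 // subr_ge0 //.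
Qed.

(** The closed end [b] may itself be a critical value and is not counted by [above]; the strict
    inequality leaves room for it. *)
Lemma card_critical (R : realType) (I : finType) (val : I -> R) opt (a b : \bar R)
    (V : set R) (L : nat) :
  (forall r, V r -> exists x, r = val x) ->
  (#|below val opt a| + #|above val opt b| < L)%N ->
  (V `&` half_open_itv a b #<= `I_L)%card.
Proof.
move=> Vval ltL.
(* When [b] is infinite, [fine b] is a dummy 0 that only lengthens the list. *)
pose s := [seq val x | x <- enum (below val opt a)] ++
          [seq val x | x <- enum (above val opt b)] ++ [:: fine b].
have sub : V `&` half_open_itv a b `<=` nth 0 s @` `I_(size s).
  move=> r [/Vval[x ->] /andP[ax xb]].
  suff xs : val x \in s by exists (index (val x) s); rewrite /= ?index_mem ?nth_index.
  rewrite !mem_cat; have [xo|xo] := ltP (val x) opt.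
    by rewrite map_f // mem_enum inE ax.
  move: xb; rewrite le_eqVlt => /orP[/eqP <-|xb]; first by rewrite /= inE eqxx !orbT.
  by rewrite [X in _ || (X || _)]map_f ?orbT // mem_enum inE xo.
apply: card_le_trans (subset_card_le sub) _.
apply: card_le_trans (card_image_le _ _) _.
rewrite card_le_II !size_cat !size_map /= -!cardE; lia.
Qed.

(** * The sampling program *)

(* X[0], X[1] are the ends of the interval, which are infinite while N[8], N[9]
   are 0.  N[6] becomes the bit length of n, N[7] counts the remaining draws, and
   N[10], N[11], N[12] are the objects and the slot that are drawn.  The code from
   line 44 on computes all the slots of that pair into X[3], X[4], .. *)
Definition sampling_code (R : realType) (sl : seq (seq (cexpr R) * nat))
    (c : nat) : seq (instr R) :=
  [:: NConst 3 1;
      NConst 4 2;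
      NConst 5 1;
      NAdd 5 5 5;
      NAdd 6 6 3;
      JumpN 5 0 3;
      NMul 7 0 0;
      NDiv 7 7 1;
      NAdd 7 7 3;
      NConst 10 (2 * size sl);
      NMul 7 7 10;
      NConst 10 c;
      NMul 10 10 6;
      NAdd 10 10 3;
      NMul 7 7 10;
      NConst 13 (size sl);
      NConst 14 3;
      JumpN 7 2 37;
      NRandom 10 0;
      NRandom 11 0;
      NRandom 12 13;
      NAdd 12 12 14;
      JumpN 2 2 44;
      XLoad 2 12;
      JumpN 8 2 26;
      JumpX 2 0 35;
      JumpN 9 2 28;
      JumpX 1 2 35;
      Decide 15 2;
      JumpN 3 15 33;
      XLoad 0 4;
      NConst 8 1;
      JumpN 2 2 35;
      XLoad 1 4;
      NConst 9 1;
      NSub 7 7 3;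
      JumpN 2 2 17;
      JumpN 8 2 41;
      JumpN 9 2 40;
      Halt (Some 0%N) (Some 1%N);
      Halt (Some 0%N) None;
      JumpN 9 2 43;
      Halt None (Some 1%N);
      Halt None None]
  ++ slots_code (3 + size sl) 3 sl ++ [:: JumpN 2 2 23].

(** Words must hold the number of draws, at most [n.+1 ^ (1 + 2 * size sl + c.+1)] when [n <= L],
    besides [n * n] and the constants of the code. *)
Definition sampling_program (R : realType) (sl : seq (seq (cexpr R) * nat))
    (c : nat) : program R :=
  Program (2 * size sl + c + 5) (sampling_code sl c).

(** * Cost and correctness of the sampling loop *)

Section Program.
Variables (R : realType) (sl : seq (seq (cexpr R) * nat)) (c : nat).
Variables (n L : nat) (inp : nat -> nat -> R) (opt : R) (D : nat).
Variables (Q2 : set (set R)).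
Hypotheses (n_gt0 : (0 < n)%N) (sl_gt0 : (0 < size sl)%N).

Let M := sampling_program sl c.
Let SL := slots_code (3 + size sl) 3 sl.
Local Notation spec := (spec M n inp opt D [set J | J opt] Q2).

Definition word_bound := (n.+1 ^ (2 * size sl + c + 5))%N.

Lemma word_small k : (k < word_bound)%N -> word M n k = k.
Proof. exact: modn_small. Qed.

Lemma expn_word_bound e : (e <= 2 * size sl + c + 5)%N -> (n.+1 ^ e <= word_bound)%N.
Proof. by move=> le; rewrite leq_exp2l. Qed.

Lemma small_word_bound k : (k <= 2 * size sl + c + 4)%N -> (k < word_bound)%N.
Proof.
move=> le; apply: leq_trans (expn_word_bound (_ : k < _)%N); last lia.
apply: (leq_trans (ltn_expl k (isT : 1 < 2)%N)).
apply: (@leq_trans (n.+1 ^ k)); last by rewrite leq_exp2l.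
by case: k {le} => // k; rewrite leq_exp2r.
Qed.

Definition lo (N : nat -> nat) (X : nat -> R) : \bar R :=
  if N 8%N == 0%N then -oo%E else (X 0%N)%:E.
Definition hi (N : nat -> nat) (X : nat -> R) : \bar R :=
  if N 9%N == 0%N then +oo%E else (X 1%N)%:E.

(** [N[2] = 0] serves in comparisons and unconditional jumps, [N[3] = 1] in increments, [N[4] = 2]
    addresses the drawn value [X[2]], and [N[14] = 3] is the register of the first slot. *)
Definition inv (N : nat -> nat) (k : nat) : Prop :=
  [/\ [/\ N 0%N = n, N 2%N = 0%N, N 3%N = 1%N & N 4%N = 2%N],
      N 13%N = size sl, N 14%N = 3%N & N 7%N = k].

Ltac run := eapply (spec_step (w := 1)); [reflexivity | rewrite /=].

Lemma continue_spec N X k b p : inv N k.+1 -> (k.+1 < word_bound)%N ->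
    (forall N', inv N' k -> N' 8%N = N 8%N -> N' 9%N = N 9%N ->
       spec (Config 17 N' X) b p) ->
  spec (Config 35 N X) (b + 2) p.
Proof.
move=> [[N0 N2 N3 N4] N13 N14 N7] kB h; run; run; rewrite leqnn.
rewrite -addrA -opprD -addrA (_ : 2 - _ = 0) ?addr0; last lra.
apply: h => //; split=> //=.
by rewrite N7 N3 subn1 word_small // ltnW.
Qed.

(** At most four jumps are executed: each end takes one test for being infinite and possibly one
    comparison. *)
Lemma test_spec N X b p : N 2%N = 0%N ->
    (hit (lo N X) (hi N X) (X 2%N) -> spec (Config 28 N X) b p) ->
    (~~ hit (lo N X) (hi N X) (X 2%N) -> spec (Config 35 N X) b p) ->
  spec (Config 24 N X) (b + 4) p.
Proof.
rewrite /hit /lo /hi => N2 hitP nohitP; run; rewrite N2 leqn0.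
have le0 : b <= b + 4 - 1 by lra.
have le1 : b <= b + 4 - 1 - 1 by lra.
have le2 : b <= b + 4 - 1 - 1 - 1 by lra.
have le3 : b <= b + 4 - 1 - 1 - 1 - 1 by lra.
case: eqP hitP nohitP => [N8|/eqP N8] hitP nohitP; last first.
  run; have [le|lt] := leP (X 2%N) (X 0%N).
    by apply: spec_le (nohitP _) => //; rewrite lte_fin ltNge le.
  run; rewrite N2 leqn0.
  case: eqP hitP nohitP => [N9|/eqP N9] hitP nohitP.
    by apply: spec_le (hitP _) => //; rewrite lte_fin lt ltry.
  run; have [le|lt'] := leP (X 1%N) (X 2%N).
    by apply: spec_le (nohitP _) => //; rewrite !lte_fin [_ < X 1%N]ltNge le andbF.
  by apply: spec_le (hitP _) => //; rewrite !lte_fin lt.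
run; rewrite N2 leqn0.
case: eqP hitP nohitP => [N9|/eqP N9] hitP nohitP.
  by apply: spec_le (hitP _) => //; rewrite ltNyr ltry.
run; have [le|lt'] := leP (X 1%N) (X 2%N).
  by apply: spec_le (nohitP _) => //; rewrite lte_fin [_ < X 1%N]ltNge le andbF.
by apply: spec_le (hitP _) => //; rewrite ltNyr lte_fin.
Qed.

Lemma update_spec N X k b p : inv N k.+1 -> (k.+1 < word_bound)%N ->
    (forall N' X', inv N' k ->
       lo N' X' = next_lo opt (lo N X) (hi N X) (X 2%N) ->
       hi N' X' = next_hi opt (lo N X) (hi N X) (X 2%N) ->
       spec (Config 17 N' X') b p) ->
  spec (Config 24 N X)
    (b + (hit (lo N X) (hi N X) (X 2%N) : nat)%:R * D.+1%:R + 10) p.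
Proof.
move=> invN kB h; have [[N0 N2 N3 N4] N13 N14 N7] := invN.
set H := hit _ _ _ in h *.
(* Four units for the test; after the decision call, six for the longest path: one jump on the
   answer, three to update the lower end, two to close the loop. *)
rewrite (_ : _ + 10 = b + (H : nat)%:R * D.+1%:R + 6 + 4); last by ring.
apply: test_spec => //; rewrite -/H => HH; last first.
  apply: spec_le (continue_spec invN kB (b := b) (p := p) _) => //.
    by rewrite (negbTE HH) mul0r; lra.
  by move=> N' invN' N8 N9; apply: h => //;
    rewrite /next_lo /next_hi -/H (negbTE HH) /lo /hi ?N8 ?N9.
eapply (spec_step (w := D.+1)); [reflexivity | rewrite /=].
rewrite HH mul1r (_ : b + _ + 6 - _ = b + 6); last by ring.
run; rewrite N3 word_small; last by
  rewrite /decide; case: ifP => _; last case: ifP => _; apply: small_word_bound; lia.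
rewrite /decide; case: ltP => [vo|ov].
  run; run; run; rewrite leqnn N4 word_small; last by apply: small_word_bound; lia.
  apply: spec_le (continue_spec (k := k) (b := b) (p := p) _ kB _) => //.
    by lra.
  move=> N' invN' N8 N9; apply: h => //.
    by rewrite /next_lo -/H HH vo /= /lo N8.
  by rewrite /next_hi -/H HH leNgt vo /= /hi N9.
(* The answers equal and larger take the same branch, because the interval is closed on the
   right. *)
have -> : (0 < if X 2%N == opt then 1 else 2)%N by case: ifP.
run; run; rewrite N4 word_small; last by apply: small_word_bound; lia.
apply: spec_le (continue_spec (k := k) (b := b) (p := p) _ kB _) => //.
  by lra.
move=> N' invN' N8 N9; apply: h => //.
  by rewrite /next_lo -/H HH ltNge ov /= /lo N8.
by rewrite /next_hi -/H HH ov /= /hi N9.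
Qed.

Lemma slots_spec N X b p : N 2%N = 0%N ->
    spec (Config 23 N (exec inp N X SL)) b p ->
  spec (Config 44 N X) (b + (size SL)%:R + 1) p.
Proof.
move=> N2 h; apply: (@spec_straight _ _ _ _ _ _ _ _ SL).
(* The fixed part of the program has 44 instructions, so reading from there on is reading the slot
   code. *)
- move=> i lti; change (nth (Halt None None) (SL ++ [:: JumpN 2 2 23]) i =
    nth (Halt None None) SL i).
  by rewrite nth_cat lti.
- exact: straight_slots.
eapply (spec_step (w := 1) (c' := Config 23 N (exec inp N X SL))).
  have : nth (Halt None None) (Defs.code M) (44 + size SL) = JumpN 2 2 23.
    change (nth (Halt None None) (SL ++ [:: JumpN 2 2 23]) (size SL) = JumpN 2 2 23).
    by rewrite nth_cat ltnn subnn.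
  by rewrite /step => ->; rewrite leqnn.
by apply: spec_le h => //; lra.
Qed.

Definition sample_value (i j s : nat) : R :=
  slot_value (fun b => inp (if b then j else i)) (nth ([::], 0%N) sl s).

(** The 14 units beyond the slot code are two steps before it, the jump back, the load of the drawn
    slot and the ten of [update_spec]. The slot code writes from register 3 on, so the ends in
    [X[0]] and [X[1]] survive. *)
Lemma body_spec i j s N X k b p : inv N k.+1 -> (k.+1 < word_bound)%N ->
    N 10%N = i -> N 11%N = j -> N 12%N = s -> (s < size sl)%N ->
    (forall N' X', inv N' k ->
       lo N' X' = next_lo opt (lo N X) (hi N X) (sample_value i j s) ->
       hi N' X' = next_hi opt (lo N X) (hi N X) (sample_value i j s) ->
       spec (Config 17 N' X') b p) ->
  spec (Config 21 N X)
    (b + (hit (lo N X) (hi N X) (sample_value i j s) : nat)%:R * D.+1%:R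
       + ((size SL)%:R + 14)) p.
Proof.
move=> invN kB N10 N11 N12 lts h; have [[N0 N2 N3 N4] N13 N14 N7] := invN.
run; run; rewrite leqnn N12 N14 word_small; last by apply: small_word_bound; lia.
set N1 := [eta N with _ |-> _].
have [slotsE frameE] := exec_slots inp N1 (base := 3 + size sl) X (leqnn (3 + size sl)).
set H := hit _ _ _ in h *.
apply: spec_le (slots_spec (N := N1) (b := b + (H : nat)%:R * D.+1%:R + 11) N2 _) => //.
  by lra.
run; rewrite addnC slotsE // (_ : slot_value _ _ = sample_value i j s); last first.
  by rewrite /sample_value; congr slot_value; apply/funext => -[]; rewrite /= ?N10 ?N11.
have lo1 x : lo N1 [eta exec inp N1 X SL with 2%N |-> x] = lo N X.
  by rewrite /lo /= frameE.
have hi1 x : hi N1 [eta exec inp N1 X SL with 2%N |-> x] = hi N X.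
  by rewrite /hi /= frameE.
have := @update_spec N1 [eta exec inp N1 X SL with 2%N |-> sample_value i j s] k b p.
rewrite lo1 hi1 /= -/H => /(_ invN kB h); apply: spec_le => //; lra.
Qed.

Lemma ltn_word_bound : (n < word_bound)%N.
Proof.
by apply: leq_trans (expn_word_bound (_ : 1 <= _)%N); rewrite ?expn1 //; lia.
Qed.

(** Three independent uniform draws are one uniform draw in this product. Diagonal pairs and slots
    that are not critical are sampled as well; they only enlarge the set of values. *)
Definition sample : finType := ('I_n * 'I_n * 'I_(size sl))%type.
Definition sampled (x : sample) : R := sample_value x.1.1 x.1.2 x.2.

Lemma average_sample (F : nat -> nat -> nat -> R) :
  average n (fun i => average n (fun j => average (size sl) (F i j))) =
  (\sum_(x : sample) F x.1.1 x.1.2 x.2) / #|sample|%:R.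
Proof.
rewrite /average !card_prod !card_ord !natrM !invfM !mulrA.
rewrite (eq_bigr (fun i : 'I_n =>
  (\sum_(j < n) \sum_(s < size sl) F i j s) / (size sl)%:R / n%:R)); last first.
  by move=> i _; rewrite -mulr_suml.
rewrite -!mulr_suml pair_big /= pair_big /=.
by rewrite mulrAC -!mulrA [X in _ * X]mulrC -!mulrA.
Qed.

Variable s : nat.
Hypothesis s_le : (s <= #|sample|)%N.
Hypothesis good : forall a b, (a < opt%:E)%E -> (opt%:E <= b)%E ->
  (#|below sampled opt a| < s)%N -> (#|above sampled opt b| < s)%N ->
  Q2 (half_open_itv a b).

Local Notation calls := (calls sampled opt).
Local Notation fail := (fail sampled opt s).

Let K : R := (size SL)%:R + 20.

Lemma exit_spec N X : N 2%N = 0%N -> (lo N X < opt%:E)%E -> (opt%:E <= hi N X)%E ->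
  spec (Config 37 N X) 3 (1 - fail 0 (lo N X) (hi N X)).
Proof.
move=> N2 lo_lt le_hi.
have halt l b : step M n inp opt D (Config l N X) =
    Stop (half_open_itv (lo N X) (hi N X)) -> 0 <= b ->
    spec (Config l N X) b (1 - fail 0 (lo N X) (hi N X)).
  move=> stepl b0; apply: (spec_stop stepl) => //.
  - by rewrite /= /half_open_itv /= lo_lt le_hi.
  - by rewrite gerBl addr_ge0 ?miss_ge0.
  by rewrite subr_gt0 => /fail_lt1[? ?]; exact: good.
run; rewrite N2 leqn0; case: eqP => [N8|/eqP/negbTE N8]; run; rewrite N2 leqn0;
  case: eqP => [N9|/eqP/negbTE N9]; (apply: halt; last lra);
  by rewrite /lo /hi ?N8 ?N9.
Qed.

(** Induction on the number of remaining draws: [sum_calls_next] controls the expected decision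
    calls and [sum_fail_next] the failure probability, once the three nested averages are merged
    into a sum over [sample]. *)
Lemma loop_spec k N X : inv N k -> (k < word_bound)%N ->
    (lo N X < opt%:E)%E -> (opt%:E <= hi N X)%E ->
  spec (Config 17 N X) (k%:R * K + 4 + D.+1%:R * calls (lo N X) (hi N X))
    (1 - fail k (lo N X) (hi N X)).
Proof.
elim: k N X => [|k IHk] N X invN kB lo_lt le_hi;
  have [[N0 N2 N3 N4] N13 N14 N7] := invN; run; rewrite N7 N2 /=.
  apply: spec_le (exit_spec N2 lo_lt le_hi) => //.
  by have := calls_ge0 sampled opt (lo N X) (hi N X);
    have : 0 <= D.+1%:R :> R by []; nra.
set a := lo N X in lo_lt *; set b := hi N X in le_hi *.
(* [F] and [P] are the budget and the success bound once objects [i], [j] and slot [u] have been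
   drawn. *)
pose F (i j u : nat) : R :=
  let v := sample_value i j u in
  k%:R * K + 4 + D.+1%:R * calls (next_lo opt a b v) (next_hi opt a b v)
  + (hit a b v : nat)%:R * D.+1%:R + ((size SL)%:R + 14).
pose P (i j u : nat) : R :=
  let v := sample_value i j u in
  1 - fail k (next_lo opt a b v) (next_hi opt a b v).
have sample_gt0 : 0 < #|sample|%:R :> R.
  by rewrite ltr0n !card_prod !card_ord !muln_gt0 n_gt0.
have FE : average n (fun i => average n (fun j => average (size sl) (F i j))) <=
    k%:R * K + 4 + D.+1%:R * calls a b + ((size SL)%:R + 14).
  rewrite average_sample ler_pdivrMr //.
  rewrite (eq_bigr (fun x : sample => k%:R * K + 4 + ((size SL)%:R + 14) +
     D.+1%:R * ((hit a b (sampled x) : nat)%:R +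
       calls (next_lo opt a b (sampled x)) (next_hi opt a b (sampled x))))); last first.
    by move=> x _; rewrite /F -/(sampled x) /=; ring.
  rewrite big_split /= -mulr_sumr sumr_const -[X in X + _]mulr_natr.
  have := sum_calls_next sampled lo_lt le_hi; set T := \sum_x _.
  have : 0 <= D.+1%:R :> R by [].
  set d := D.+1%:R; set m := _%:R; set e := _ + _ + _ => d0 hT.
  have : d * T <= d * (m * calls a b) by rewrite ler_wpM2l.
  by rewrite /e; nra.
have PE : 1 - fail k.+1 a b <=
    average n (fun i => average n (fun j => average (size sl) (P i j))).
  rewrite average_sample ler_pdivlMr //.
  rewrite /P big_split /= sumrN sumr_const.
  have := sum_fail_next sampled lo_lt le_hi s_le k.
  by rewrite mulrBl mul1r lerD2l lerN2 mulrC.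
have nE : maxn 1 (N 0%N) = n by rewrite N0; apply/maxn_idPr.
have sE : maxn 1 (N 13%N) = size sl by rewrite N13; apply/maxn_idPr.
eapply (spec_move (w := 1)
  (bv := fun i => average n (fun j => average (size sl) (F i j)) + 2)
  (pv := fun i => average n (fun j => average (size sl) (P i j)))).
- reflexivity.
- by rewrite nE.
- rewrite nE => i lti /=; rewrite word_small; last exact: ltn_trans ltn_word_bound.
  eapply (spec_move (w := 1)
    (bv := fun j => average (size sl) (F i j) + 1)
    (pv := fun j => average (size sl) (P i j))).
  + reflexivity.
  + by rewrite /= nE.
  + rewrite /= nE => j ltj /=; rewrite word_small; last exact: ltn_trans ltn_word_bound.
    eapply (spec_move (w := 1) (bv := F i j) (pv := P i j)).
    * reflexivity.
    * by rewrite /= sE.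
    * rewrite /= sE => u ltu /=; rewrite word_small; last first.
        by apply: small_word_bound; lia.
      apply: (body_spec (k := k) (i := i) (j := j) (s := u)) => //.
      move=> N' X' invN' lo' hi'.
      have := IHk N' X' invN' (ltnW kB).
      rewrite lo' hi'; apply; first exact: next_lo_lt.
      exact: le_next_hi.
    * by rewrite /= sE addrC.
    * by rewrite /= sE.
  + by rewrite /= nE averageD average_cst //; lra.
  + by rewrite /= nE.
- by move: FE; rewrite nE averageD average_cst // -[k.+1%:R]natr1 /K; lra.
- by rewrite nE.
Qed.

(** * Computation of the number of draws *)

Let l := (trunc_log 2 n).+1.

Lemma bits_le : (l <= n)%N.
Proof.
have /andP[] := trunc_log_bounds (isT : 1 < 2)%N n_gt0.
by move=> /(leq_trans (ltn_expl _ (isT : 1 < 2)%N)).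
Qed.

(** Three instructions per round double [N[5]], increment [N[6]] and compare with [n]; [j] counts
    the rounds still to come after the current one. *)
Lemma bits_loop_spec j i N X b p : (i + j = trunc_log 2 n)%N ->
    N 0%N = n -> N 3%N = 1%N -> N 5%N = (2 ^ i)%N -> N 6%N = i ->
    (forall N', (forall r, r != 5%N -> r != 6%N -> N' r = N r) -> N' 6%N = l ->
       spec (Config 6 N' X) b p) ->
  spec (Config 3 N X) (b + 3 * j.+1%:R) p.
Proof.
have /andP[lel ltl] := trunc_log_bounds (isT : 1 < 2)%N n_gt0.
elim: j i N => [|j IHj] i N ij N0 N3 N5 N6 h.
  rewrite addn0 in ij.
  (* The last doubling exceeds [n] but is at most [2 * n], hence still fits in a word. *)
  have wb : (2 ^ i + 2 ^ i < word_bound)%N.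
    apply: leq_trans (expn_word_bound (_ : 2 <= _)%N); last lia.
    by rewrite ij; move: n_gt0 lel; set q := (2 ^ _)%N; rewrite expnS expn1; nia.
  have wl : (l < word_bound)%N by exact: leq_ltn_trans bits_le ltn_word_bound.
  run; run; run.
  rewrite N5 word_small // N0 addnn -mul2n -expnS leqNgt ij ltl /=.
  apply: spec_le (h _ _ _) => //; first lra.
  - by move=> r /negbTE r5 /negbTE r6; rewrite /= r6 r5.
  - by rewrite /= N6 N3 addn1 ij word_small.
have lei : (2 ^ i.+1 <= n)%N by apply: leq_trans lel; rewrite leq_exp2l // -ij; lia.
have wb : (2 ^ i.+1 < word_bound)%N by exact: leq_ltn_trans lei ltn_word_bound.
have wi : (i.+1 < word_bound)%N by exact: ltn_trans (ltn_expl _ _) wb.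
run; run; run.
rewrite N5 addnn -mul2n -expnS word_small // N0 lei.
apply: spec_le (IHj i.+1 _ _ _ _ _ _ _) => //=.
- by rewrite -[j.+2%:R]natr1; lra.
- by rewrite addSnnS.
- by rewrite N6 N3 addn1 word_small.
move=> N' hN'; apply: h => r r5 r6; rewrite hN' //=.
by rewrite (negbTE r5) (negbTE r6).
Qed.

(** The first two factors give enough draws to halve the failure bound of one side when [s] is at
    least [L / 2]; the last one repeats this until the bound is at most half of [n ^- c]. *)
Definition iterations := ((n * n %/ L).+1 * (2 * size sl) * (c * l).+1)%N.

Hypothesis n_le_L : (n <= L)%N.

Lemma sq_div_le : (n * n %/ L <= n)%N.
Proof. by apply: leq_trans (leq_div2l _ n_gt0 n_le_L) _; rewrite mulnK. Qed.

Lemma iterations_small : (iterations < word_bound)%N.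
Proof.
have two_le k : (2 ^ k <= n.+1 ^ k)%N by case: k => // k; rewrite leq_exp2r.
have hS : (2 * size sl <= n.+1 ^ (2 * size sl))%N.
  by apply: leq_trans (two_le _); exact/ltnW/ltn_expl.
have hc : ((c * l).+1 <= n.+1 ^ c.+1)%N.
  rewrite expnSr; apply: leq_trans (_ : c.+1 * n.+1 <= _)%N.
    by have := bits_le; nia.
  by rewrite leq_mul2r; apply/orP; right; apply: leq_trans (two_le _); exact: ltn_expl.
have hn : ((n * n %/ L).+1 <= n.+1 ^ 1)%N by rewrite expn1 ltnS sq_div_le.
have := leq_mul (leq_mul hn hS) hc; rewrite -!expnD => h.
by apply: leq_ltn_trans h _; rewrite ltn_exp2l //; lia.
Qed.

(** The constant 18 consists of three instructions before the loop on the bit length, eleven after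
    it, and the 4 units of [loop_spec]. *)
Lemma program_spec :
  spec (init R n L)
    (3 * l%:R + 18 + (iterations%:R * K + D.+1%:R * calls -oo%E +oo%E))
    (1 - fail iterations -oo%E +oo%E).
Proof.
have itP := iterations_small.
have it_gt0 : (0 < (n * n %/ L).+1 * (2 * size sl))%N by rewrite !muln_gt0 sl_gt0.
(* The successive products divide [iterations], so none of them is truncated to a smaller word. *)
have small a b : (a * b = iterations)%N -> (0 < a)%N -> (0 < b)%N ->
    (a < word_bound)%N /\ (b < word_bound)%N.
  move=> ab a0 b0; split; apply: leq_ltn_trans itP; rewrite -ab.
    exact: leq_pmulr.
  exact: leq_pmull.
have [w1 w2] := small _ _ (erefl iterations) it_gt0 (ltn0Sn _).
have [w3 w4] : ((n * n %/ L).+1 < word_bound)%N /\ (2 * size sl < word_bound)%N.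
  split; apply: leq_ltn_trans w1; first by apply: leq_pmulr; rewrite muln_gt0.
  exact: leq_pmull.
have wc : (c < word_bound)%N by apply: small_word_bound; lia.
have w5 := ltn_trans (ltnSn _) w2.
have w6 : (n * n < word_bound)%N.
  apply: leq_trans (expn_word_bound (_ : 2 <= _)%N); last lia.
  by rewrite expnS expn1; nia.
have ws : (size sl < word_bound)%N by apply: small_word_bound; lia.
have s1 : word M n 1 = 1%N by apply: word_small; apply: small_word_bound; lia.
have s2 : word M n 2 = 2%N by apply: word_small; apply: small_word_bound; lia.
have s3 : word M n 3 = 3%N by apply: word_small; apply: small_word_bound; lia.
rewrite /init.
run; run; run; rewrite s1 s2.
set B : R := iterations%:R * K + D.+1%:R * calls -oo%E +oo%E.
apply: spec_le (@bits_loop_spec (trunc_log 2 n) 0 _ _ (B + 15)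
  (1 - fail iterations -oo%E +oo%E) _ _ _ _ _ _) => //=.
  by rewrite -/l; lra.
move=> N hN N6.
do 11 run.
rewrite !(hN 0%N) ?(hN 1%N) ?(hN 3%N) //= N6 s3.
rewrite (word_small w6) addn1 (word_small w4) (word_small wc) !addn1.
rewrite (word_small (ltn_trans (ltnSn _) w3)) (word_small w3) (word_small w1).
rewrite (word_small w5) (word_small w2) (word_small itP) (word_small ws).
set N' := [eta _ with _ |-> _].
have lo' : lo N' (fun=> 0) = -oo%E by rewrite /lo /= hN.
have hi' : hi N' (fun=> 0) = +oo%E by rewrite /hi /= hN.
have := @loop_spec iterations N' (fun=> 0) _ itP.
rewrite lo' hi' ltNyr leey => h; apply: spec_le (h _ _ _) => //.
  by rewrite /B; lra.
by split; first split; rewrite /= ?hN.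
Qed.

End Program.

(** * Asymptotic bounds *)

(** From [1 + y <= expR y] at [y = eps * ln n], since the binary logarithm is at most
    [ln n / ln 2]. *)
Lemma bits_le_powR (R : realType) (eps : R) n : 0 < eps -> (0 < n)%N ->
  (trunc_log 2 n).+1%:R <= (1 + (eps * ln 2)^-1) * n%:R `^ eps.
Proof.
move=> eps0 n0; have ln2 : 0 < ln 2 :> R by rewrite ln_gt0 // ltr1n.
have n0R : 0 < n%:R :> R by rewrite ltr0n.
have lnn : 0 <= ln n%:R :> R by rewrite ln_ge0 // ler1n.
have e0 : 0 < eps * ln 2 by rewrite mulr_gt0.
have hy : 1 + eps * ln n%:R <= n%:R `^ eps.
  by rewrite /powR gt_eqF // expR_ge1Dx.
have htl : (trunc_log 2 n)%:R * ln 2 <= ln n%:R :> R.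
  rewrite mulr_natl -lnXn ?ltr0n // -natrX ler_ln ?posrE ?ltr0n ?expn_gt0 //.
  by rewrite ler_nat; have /andP[] := trunc_log_bounds (isT : 1 < 2)%N n0.
rewrite mulrDl mul1r -natr1 addrC lerD //.
  by apply: le_trans hy; rewrite lerDl mulr_ge0 // ltW.
by rewrite ler_pdivlMl //; nra.
Qed.

(** The left side is the right side times [(n / L) ^ (2 / (t + 1))], a factor at most 1 because
    [n <= L]. *)
Lemma sq_div_le_powR (R : realType) (t n L : nat) :
  (0 < t)%N -> (0 < n)%N -> (n <= L)%N ->
  n%:R ^+ 2 / L%:R <= n%:R `^ ((2 * t)%:R / (t + 1)%:R) /
                      L%:R `^ ((t - 1)%:R / (t + 1)%:R) :> R.
Proof.
move=> t0 n0 nL; pose g : R := 2 / (t + 1)%:R.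
have t1 : (t + 1)%:R != 0 :> R by rewrite pnatr_eq0 addn1.
have n0R : n%:R != 0 :> R by rewrite pnatr_eq0 -lt0n.
have L0 : (0 < L)%N by exact: leq_trans nL.
have L0R : L%:R != 0 :> R by rewrite pnatr_eq0 -lt0n.
have nE : n%:R ^+ 2 = n%:R `^ ((2 * t)%:R / (t + 1)%:R) * n%:R `^ g :> R.
  rewrite -powRD; last by rewrite n0R implybT.
  rewrite -powR_mulrn // /g -mulrDl; congr powR.
  by rewrite natrM natrD; field; rewrite natr1 pnatr_eq0.
have LE : L%:R = L%:R `^ ((t - 1)%:R / (t + 1)%:R) * L%:R `^ g :> R.
  rewrite -powRD; last by rewrite L0R implybT.
  rewrite -[LHS]powRr1 // /g -mulrDl; congr powR.
  by rewrite natrB // natrD; field; rewrite natr1 pnatr_eq0.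
have g0 : 0 <= g by rewrite divr_ge0.
have Lg0 : 0 < L%:R `^ g :> R by rewrite powR_gt0 // ltr0n.
have gle : n%:R `^ g <= L%:R `^ g :> R by rewrite ge0_ler_powR ?nnegrE ?ler_nat.
rewrite nE {1}LE invfM mulrACA ler_piMr ?divr_ge0 ?powR_ge0 //.
by rewrite ler_pdivrMr // mul1r.
Qed.

(** On each side [half_power] with [q = s / #|I|] gives at most [2 ^- w], that is at most half of
    [n ^- c]. *)
Lemma fail_iterations_le (R : realType) (I : finType) (val : I -> R) (opt : R)
    (a b : \bar R) (s u w n c : nat) : (0 < n)%N -> (0 < #|I|)%N ->
    (s <= #|I|)%N -> (#|I| <= u * s)%N -> (n ^ c * 2 <= 2 ^ w)%N ->
  fail val opt s (u * w) a b <= n%:R ^- c.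
Proof.
move=> n0 I0 sI Iu hw; have nc0 : (0 < n ^ c)%N by rewrite expn_gt0 n0.
have missle k : miss R I s (u * w) k <= (n ^ c * 2)%:R^-1.
  rewrite /miss; case: ifP => _; last by rewrite invr_ge0.
  apply: le_trans (half_power _ _ _) _.
  - by rewrite divr_ge0 //= ler_pdivrMr ?ltr0n // mul1r ler_nat.
  - by rewrite mulrA ler_pdivlMr ?ltr0n // mul1r -natrM ler_nat.
  by rewrite lef_pV2 ?posrE ?ltr0n ?expn_gt0 ?muln_gt0 ?nc0 // ler_nat.
rewrite /fail; apply: le_trans (lerD (missle _) (missle _)) _.
rewrite natrM natrX invfM -mulrDr; set y := _^-1; lra.
Qed.

Lemma calls_le (R : realType) (I : finType) (val : I -> R) opt a b k :
  (#|I| <= 2 ^ k)%N -> calls val opt a b <= 2 * k.+1%:R.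
Proof.
move=> Ik; have h (A : {set I}) : harmonic_sum R #|A| <= k.+1%:R.
  apply: le_trans (harmonic_sum_expn2 R k); apply: harmonic_sum_homo.
  exact: leq_trans (max_card _) Ik.
by rewrite mulr_natl mulr2n lerD.
Qed.

(** * Instantiation with the slots of the given predicate *)

Lemma input_pair (R : realType) (n t : nat) (S : 'I_n -> 'rV[R]_t) (i j : 'I_n) :
  (fun b : bool => input S (if b then j : nat else i)) = pair_params (S i) (S j).
Proof.
by apply/funext => b; apply/funext => k;
  rewrite /input /pair_params; case: b; rewrite valK.
Qed.

Theorem theorem2p4 (R : realType) (t d : nat) (Phi : ord.formula R)
    (Pi : set 'rV[R]_d -> set 'rV[R]_d -> R -> Prop) (c : nat)
    (t_gt0 : (0 < t)%N)
    (saPhi : semialgebraic_formula Phi)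
    (saPi : semialgebraic_predicate t Phi Pi) :
  exists M : program R,
  forall eps : R, 0 < eps ->
  exists2 C : R, 0 < C &
  forall (n : nat) (S : 'I_n -> 'rV[R]_t) (L : nat)
    (P : rel 'I_n -> Prop) (rstar : R) (D : nat -> nat),
  let o := fun i => object (d := d) Phi (S i) in
  injective o ->
  r_monotone Pi o ->
  critical_values_attained Pi o ->
  monotone_graph_property P ->
  is_minimum [set r | P (growth_graph Pi o r)] rstar ->
  (n <= L)%N -> (L < 'C(n, 2))%N ->
  [/\ output_prob M n L (input S) rstar (D n) [set J | J rstar] = 1%E,
      (output_prob M n L (input S) rstar (D n)
         [set J | (critical_values Pi o `&` J #<= `I_L)%card] >=
         (1 - n%:R ^- c)%:E)%E &
      (expected_time M n L (input S) rstar (D n) <=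
         (C * n%:R `^ eps *
          (n%:R `^ ((2 * t)%:R / (t + 1)%:R) /
             L%:R `^ ((t - 1)%:R / (t + 1)%:R)
           + (D n)%:R))%:E)%E ].
Proof.
case: saPi => f saf PiE.
set sl := slots t f; pose sz := size sl.
pose K : R := (size (slots_code (3 + size sl) 3 sl))%:R + 20.
exists (sampling_program sl c) => eps eps0.
(* The summands come from the set-up (21), the decision calls ([6 + 2 * sz]) and the draws. *)
pose A : R := 27 + 2 * sz%:R + 4 * sz%:R * c.+1%:R * K.
have K0 : 0 < K by rewrite ltr_wpDl.
have A0 : 0 < A by rewrite ltr_wpDr // !mulr_ge0 // ltW.
have C0 : 0 < 1 + (eps * ln 2)^-1 :> R.
  by rewrite addr_gt0 // invr_gt0 mulr_gt0 // ln_gt0 // ltr1n.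
exists (A * (1 + (eps * ln 2)^-1)); first exact: mulr_gt0.
move=> n S L P rstar D o _ _ _ _ _ nL LC.
have n_gt0 : (0 < n)%N by case: n S P o nL LC => // ? ? ?; rewrite bin0n.
have L_gt0 : (0 < L)%N by exact: leq_trans nL.
have L_le : (L <= n * n)%N.
  by apply: ltnW; apply: leq_trans LC _; rewrite bin2; nia.
have sl_gt0 : (0 < size sl)%N by [].
set inp := input S; set l := trunc_log 2 n.
(* Fewer than [s] values on each side leave at most [2 * s - 2 < L] in all, while [L <= 2 * s] keeps
   the chance of reaching the [s] closest values large. *)
pose s := (uphalf L); pose I := sample sl n; pose v : I -> R := sampled inp.
have cardI : #|{: I}| = (n * n * sz)%N by rewrite !card_prod !card_ord.
have s2 : (L <= 2 * s)%N by rewrite /s; lia.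
have sI : (s <= #|{: I}|)%N.
  rewrite cardI; apply: leq_trans (_ : L <= _)%N; first by rewrite /s; lia.
  by apply: leq_trans L_le _; rewrite leq_pmulr.
pose V := critical_values Pi o.
have Vval r : V r -> exists x, r = v x.
  move=> [i [j [_ [minA minB]]]].
  have [|k ltk ->] := @minimum_is_slot R t (S i) (S j) f r saf.
    by split=> [|y /PiE /minB]//; apply/PiE.
  by exists (i, j, Ordinal ltk); rewrite -input_pair.
have good a b : (a < rstar%:E)%E -> (rstar%:E <= b)%E ->
    (#|below v rstar a| < s)%N -> (#|above v rstar b| < s)%N ->
    [set J | (V `&` J #<= `I_L)%card] (half_open_itv a b).
  move=> _ _ lts lts'; apply: (card_critical Vval (opt := rstar)).
  by move: lts lts'; rewrite /s; lia.
have [-> prob time] := spec_output (program_spec c (D n) n_gt0 sl_gt0 sI good nL).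
have ltn2l : (n < 2 ^ l.+1)%N.
  by have /andP[] := trunc_log_bounds (isT : 1 < 2)%N n_gt0.
split=> //.
  apply: le_trans prob; rewrite lee_fin lerD2l lerN2.
  apply: fail_iterations_le => //.
  - by rewrite cardI !muln_gt0 n_gt0.
  - rewrite cardI; have := ltn_ceil (n * n) L_gt0; rewrite -/sz; nia.
  rewrite expnS [leqLHS]mulnC leq_mul2l /= mulnC expnM.
  by case: (c) => // k; rewrite leq_exp2r // ltnW.
apply: le_trans time _; rewrite lee_fin.
set T0 := _ / _ `^ _; pose x : R := n%:R ^+ 2 / L%:R.
have xT : x <= T0 by exact: sq_div_le_powR.
(* Since [L <= n * n], additive constants are absorbed into [x]. *)
have x1 : 1 <= x by rewrite ler_pdivlMr ?ltr0n // mul1r -natrX ler_nat expnS expn1.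
have lP := bits_le_powR eps0 n_gt0; rewrite -/l in lP.
(* The sample space has at most [2 ^ (2 * l.+1 + sz)] elements, so its harmonic number is linear in
   the bit length. *)
have callsP : calls v rstar -oo%E +oo%E <= 2 * (2 * l.+1 + sz).+1%:R.
  apply: calls_le; rewrite cardI expnD [(2 * _)%N]mulnC expnM -mulnn.
  by apply: leq_mul; [apply: leq_mul|exact/ltnW/ltn_expl]; exact: ltnW.
have itP : (iterations sl c n L)%:R <= 4 * sz%:R * c.+1%:R * l.+1%:R * x.
  rewrite /iterations -/sz -/l !natrM.
  have h1 : (n * n %/ L).+1%:R <= 2 * x.
    have : (n * n %/ L)%:R <= x.
      rewrite /x ler_pdivlMr ?ltr0n // -natrM -natrX.
      by rewrite ler_nat expnS expn1 leq_trunc_div.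
    by rewrite -natr1; lra.
  have h2 : (c * l.+1).+1%:R <= c.+1%:R * l.+1%:R :> R.
    by rewrite -natrM ler_nat mulSn; lia.
  have -> : 4 * sz%:R * c.+1%:R * l.+1%:R * x =
    2 * x * (2 * sz%:R) * (c.+1%:R * l.+1%:R) by ring.
  by rewrite !ler_pM // ?mulr_ge0 // (le_trans ler01).
have l1 : 1 <= l.+1%:R :> R by rewrite ler1n.
(* All logarithmic factors are gathered in [l.+1], which [lP] bounds by a multiple of [n ^ eps]. *)
apply: (@le_trans _ _ (A * l.+1%:R * (x + (D n)%:R))); last first.
  apply: ler_pM => //.
  - by rewrite mulr_ge0 // ltW.
  - by rewrite addr_ge0 // (le_trans ler01).
  - by rewrite -mulrA ler_pM2l.
  - by rewrite lerD2r.
have D0 : 0 <= (D n)%:R :> R by [].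
have itK : (iterations sl c n L)%:R * K <=
    4 * sz%:R * c.+1%:R * K * l.+1%:R * (x + (D n)%:R).
  have -> : 4 * sz%:R * c.+1%:R * K * l.+1%:R * (x + (D n)%:R) =
    4 * sz%:R * c.+1%:R * l.+1%:R * x * K + 4 * sz%:R * c.+1%:R * K * l.+1%:R * (D n)%:R
    by ring.
  by rewrite -[leLHS]addr0 lerD ?ler_pM2r // !mulr_ge0 // ltW.
have DC : (D n).+1%:R * calls v rstar -oo%E +oo%E <=
    (6 + 2 * sz%:R) * l.+1%:R * (x + (D n)%:R).
  rewrite mulrC ler_pM //.
  - exact: calls_ge0.
  - apply: le_trans callsP _; rewrite -[(_ + sz).+1%:R]natr1 natrD natrM.
    have : 0 <= sz%:R :> R by []; nra.
  - by rewrite -natr1 addrC lerD2r.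
have rest : 3 * l.+1%:R + 18 <= 21 * l.+1%:R * (x + (D n)%:R) by nra.
rewrite -/l -/K -/v.
have -> : A * l.+1%:R * (x + (D n)%:R) = 21 * l.+1%:R * (x + (D n)%:R) +
  (4 * sz%:R * c.+1%:R * K * l.+1%:R * (x + (D n)%:R) +
   (6 + 2 * sz%:R) * l.+1%:R * (x + (D n)%:R)) by rewrite /A; ring.
by rewrite !lerD.
Qed.
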